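(* Let $\mathscr{A}=(G,\partial)$ be a unicyclization of a connected graph $G$, let $\beta$ be a fixed basis of $Z_1(G)=\ker\partial_1$, and let $w_{\mathscr{A}}(z)=\det([z]_\beta,[\partial]_\beta)$ be the winding number map relative to $\beta$. Then $$\lambda_{\mathscr{A}}=\sum_{Y\in\mathcal{U}(G)}w_{\mathscr{A}}(z_Y)\cdot z_Y$$ is a non-zero harmonic cycle of $\mathscr{A}$, i.e. $\lambda_{\mathscr{A}}\neq 0$ and $\lambda_{\mathscr{A}}\in\ker(\partial_1^t\partial_1+\partial\,\partial^t)=\ker\partial_1\cap\ker\partial^t$.
   Context: Graphs are finite and connected; loops and multiple edges are allowed. Fix an orientation of each edge. $C_1(G)=\mathbb{Z}^{E(G)}$, $C_0(G)=\mathbb{Z}^{V(G)}$, and $\partial_1:C_1(G)\to C_0(G)$ is the (oriented) incidence matrix (a loop gives a zero column). $Z_1(G)=\ker\partial_1$ is a free abelian group of rank $m=|E(G)|-|V(G)|+1$. A unicyclizer of $G$ is an integer matrix $\partial$ (rows indexed by $E(G)$) with (1) $\ker\partial=0$, (2) $\partial_1\partial=0$, (3) $\operatorname{rk}(\ker\partial_1/\operatorname{im}\partial)=1$. So $\partial$ has $m-1$ linearly independent columns, all in $Z_1(G)$ (when $m=1$ it has no columns). The pair $\mathscr{A}=(G,\partial)$ is called a unicyclization of $G$; its associated chain complex is $\mathbb{Z}^{m-1}\xrightarrow{\partial}C_1(G)\xrightarrow{\partial_1}C_0(G)$. A (1-dimensional) harmonic cycle is an element of the kernel of the combinatorial Laplacian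 $\partial_1^t\partial_1+\partial\,\partial^t$ on $C_1(G;\mathbb{R})$. For a basis $\beta$ of $Z_1(G)$, $[z]_\beta\in\mathbb{Z}^m$ is the coordinate column vector of $z\in Z_1(G)$, $[\partial]_\beta$ is the $m\times(m-1)$ matrix whose columns are the coordinate vectors of the columns of $\partial$, and $([z]_\beta,[\partial]_\beta)$ is the $m\times m$ matrix with first column $[z]_\beta$. A cycletree of $G$ is a connected spanning subgraph $Y$ of $G$ containing exactly one cycle $C_Y$ (a loop, or a pair of parallel edges, may be that cycle). $\mathcal{U}(G)$ is the set of cycletrees of $G$. $z_Y\in Z_1(G)$ is the $\{0,\pm1\}$-vector of $C_Y$ with either orientation chosen; the product $w_{\mathscr{A}}(z_Y)\cdot z_Y$ does not depend on this choice. *)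

(* Defs.v *)
From HB Require Import structures.
From mathcomp Require Import classical_sets reals.
From mathcomp Require Import all_boot all_order all_algebra.

Set Implicit Arguments.
Unset Strict Implicit.
Unset Printing Implicit Defensive.

Import Order.TTheory GRing.Theory Num.Theory.
Local Open Scope ring_scope.

(* Loops and parallel edges are allowed; [esrc] and [etgt] record the fixed
   orientation of each edge. *)
Record mgraph := MGraph {
  vert : finType;
  edge : finType;
  esrc : edge -> vert;
  etgt : edge -> vert }.

Section Graph.
Variable G : mgraph.
Implicit Types (Y C : {set edge G}).

Definition adj Y : rel (vert G) := fun u v =>
  [exists e in Y, ((esrc e == u) && (etgt e == v))
               || ((esrc e == v) && (etgt e == u))].

(* A spanning subgraph is identified with its set of edges. *)
Definition spanning_connected Y : bool :=
  [forall u, forall v, connect (adj Y) u v].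

Definition connected_graph : bool :=
  (0 < #|vert G|)%N && spanning_connected [set: edge G].

(* Chains are integer column vectors, coordinates being indexed through the
   canonical enumerations of [vert G] and [edge G]. *)
Definition bd1 : 'M[int]_(#|vert G|, #|edge G|) :=
  \matrix_(i, j) ((etgt (enum_val j) == enum_val i)%:R
                  - (esrc (enum_val j) == enum_val i)%:R).

(* [(e, false)] is [e] traversed along its orientation, [(e, true)] is [e]
   traversed backwards. *)
Definition dsrc (d : edge G * bool) := if d.2 then etgt d.1 else esrc d.1.
Definition dtgt (d : edge G * bool) := if d.2 then esrc d.1 else etgt d.1.

(* A cycle with a chosen orientation and starting point: a nonempty closed walk
   without repeated vertex or edge. Length 1 is a loop; for length 2, distinctness
   of the edges forces a pair of parallel edges. *)
Definition ocycle (s : seq (edge G * bool)) : bool :=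
  [&& s != [::], uniq (map fst s), uniq (map dsrc s) &
      cycle (fun d d' => dtgt d == dsrc d') s].

(* The length of the walk is [#|C|] because its edges are distinct. *)
Definition is_cycle C : bool :=
  [exists s : #|C|.-tuple (edge G * bool),
     ocycle s && ([set e in map fst s] == C)].

Definition cycletrees : {set {set edge G}} :=
  [set Y | spanning_connected Y
         & #|[set C : {set edge G} | is_cycle C & C \subset Y]| == 1%N].

Definition ocycle_vec (s : seq (edge G * bool)) : 'cV[int]_#|edge G| :=
  \sum_(d <- s) (-1) ^+ d.2 *: delta_mx (enum_rank d.1) 0.

(* For a cycletree [Y] exactly two vectors qualify, one for each orientation of
   its unique cycle. *)
Definition cycle_vec_of Y (z : 'cV[int]_#|edge G|) : Prop :=
  exists s : seq (edge G * bool),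
    [/\ ocycle s, {subset map fst s <= Y} & z = ocycle_vec s].

Section Unicyclizer.
(* The number [n] of columns is not prescribed: that it is one less than the rank
   of the kernel of [bd1] follows from [unicyclizer]. *)
Variables (n : nat) (bd2 : 'M[int]_(#|edge G|, n)).

(* The classes of the columns of [Z] are linearly independent over the integers
   in the quotient by the image of [bd2]. *)
Definition indep_mod_im k (Z : 'M[int]_(#|edge G|, k)) : Prop :=
  forall c : 'cV[int]_k,
    (exists x : 'cV[int]_n, Z *m c = bd2 *m x) -> c = 0.

(* The rank of an abelian group is the largest size of an independent family. *)
Definition rank_ker_mod_im (r : nat) : Prop :=
  (exists Z : 'M[int]_(#|edge G|, r), bd1 *m Z = 0 /\ indep_mod_im Z) /\
  (forall k (Z : 'M[int]_(#|edge G|, k)),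
     bd1 *m Z = 0 -> indep_mod_im Z -> (k <= r)%N).

Definition unicyclizer : Prop :=
  [/\ forall x : 'cV[int]_n, bd2 *m x = 0 -> x = 0,
      bd1 *m bd2 = 0
    & rank_ker_mod_im 1].

Definition laplacian : 'M[int]_#|edge G| := bd1^T *m bd1 + bd2 *m bd2^T.

Definition harmonic (R : realType) (x : 'cV[R]_#|edge G|) : Prop :=
  map_mx intr laplacian *m x = 0.

End Unicyclizer.

Section Winding.
Variables (m : nat) (beta : 'M[int]_(#|edge G|, m)).

(* The columns of [beta] form a basis of the kernel of [bd1]. *)
Definition Z1_basis : Prop :=
  [/\ bd1 *m beta = 0,
      forall c : 'cV[int]_m, beta *m c = 0 -> c = 0
    & forall z : 'cV[int]_#|edge G|, bd1 *m z = 0 ->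
        exists c : 'cV[int]_m, beta *m c = z].

(* The default value 0 is only returned outside the span of [beta]. *)
Definition coord_vec (z : 'cV[int]_#|edge G|) : 'cV[int]_m :=
  xget 0 (fun c : 'cV[int]_m => beta *m c = z).

Definition coord_mx n (A : 'M[int]_(#|edge G|, n)) : 'M[int]_(m, n) :=
  \matrix_(i, j) coord_vec (col j A) i 0.

(* For a unicyclizer [bd2] and a basis [beta] one always has [m = 1 + n], and
   [conform_mx] is then just the cast of an [m x (1 + n)] matrix to a square
   matrix; its default value 0 is never used. *)
Definition winding n (bd2 : 'M[int]_(#|edge G|, n)) (z : 'cV[int]_#|edge G|)
    : int :=
  \det (conform_mx (0 : 'M[int]_m) (row_mx (coord_vec z) (coord_mx bd2))).

(* [zc Y] is the vector of the unique cycle of [Y], for an arbitrary choice of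
   orientations. *)
Definition std_harmonic_cycle n (bd2 : 'M[int]_(#|edge G|, n))
    (zc : {set edge G} -> 'cV[int]_#|edge G|) : 'cV[int]_#|edge G| :=
  \sum_(Y in cycletrees) winding bd2 (zc Y) *: zc Y.

End Winding.
End Graph.
Arguments bd1 : clear implicits.

(* Main.v *)
(* Every cycle [z] is the sum, over the edges [e] outside a spanning tree [T], of
   [z(e)] times the fundamental cycle of [e] with respect to [T]. Summing over the
   [k] spanning trees and grouping the pairs [(T, e)] by the cycletree [e |: T]
   gives the projection formula [\sum_Y <z_Y, z> z_Y = k z]. The winding number is a
   nonzero linear form [w] that vanishes on the columns of the unicyclizer, and the
   formula yields [<lambda, z> = k w(z)] for every cycle [z]; hence [lambda] is
   nonzero and orthogonal to these columns. *)
Require Import Defs.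
From HB Require Import structures.
From mathcomp Require Import classical_sets reals.
From mathcomp Require Import all_boot all_order all_algebra.

Set Implicit Arguments.
Unset Strict Implicit.
Unset Printing Implicit Defensive.

Import Order.TTheory GRing.Theory Num.Theory.
Local Open Scope ring_scope.

(** * Boundaries, cuts and the vectors of cycles *)

Section Cycles.
Variable G : mgraph.
Implicit Types (T Y : {set edge G}) (s : seq (edge G * bool)).
Implicit Types (z : 'cV[int]_#|edge G|) (e : edge G).

Lemma sum_edge (V : nmodType) (F : 'I_#|edge G| -> V) :
  \sum_i F i = \sum_e F (enum_rank e).
Proof. by rewrite (reindex enum_rank) //; apply/onW_bij/enum_rank_bij. Qed.

Lemma bd1E z (v : vert G) :
  (bd1 G *m z) (enum_rank v) 0 =
  \sum_e ((etgt e == v)%:R - (esrc e == v)%:R) * z (enum_rank e) 0.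
Proof.
by rewrite mxE sum_edge; apply: eq_bigr => e _; rewrite mxE !enum_rankK.
Qed.

Lemma adj_sym Y : symmetric (adj Y).
Proof. by move=> u v; apply: eq_existsb => e; rewrite orbC. Qed.

Lemma connect_adj_sym Y : connect_sym (adj Y).
Proof. exact: sym_connect_sym (adj_sym Y). Qed.

Lemma adj_edge Y e : e \in Y -> adj Y (esrc e) (etgt e).
Proof. by move=> eY; apply/exists_inP; exists e; rewrite // !eqxx. Qed.

Lemma adjP Y u v :
  reflect (exists d : edge G * bool, [/\ d.1 \in Y, dsrc d = u & dtgt d = v])
          (adj Y u v).
Proof.
apply: (iffP exists_inP) => [[e eY /orP[]/andP[/eqP <- /eqP <-]]|].
- by exists (e, false).
- by exists (e, true).
by case=> -[e []] /= [eY <- <-]; exists e => //; rewrite !eqxx ?orbT.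
Qed.

Lemma connect_adjS T Y u v :
  T \subset Y -> connect (adj T) u v -> connect (adj Y) u v.
Proof.
move=> sTY; apply: connect_sub => x y /adjP[d [dT dx dy]].
by apply/connect1/adjP; exists d; rewrite (subsetP sTY).
Qed.

Lemma spanning_connectedP Y :
  reflect (forall u v, connect (adj Y) u v) (spanning_connected Y).
Proof.
by apply: (iffP forallP) => [h u v|h u]; [apply: (forallP (h u))|apply/forallP].
Qed.

Lemma spanning_connectedS T Y :
  T \subset Y -> spanning_connected T -> spanning_connected Y.
Proof.
move=> sTY /spanning_connectedP h; apply/spanning_connectedP=> u v.
exact: connect_adjS (h u v).
Qed.

Lemma spanning_connectedD1 Y e :
  spanning_connected Y -> connect (adj (Y :\ e)) (esrc e) (etgt e) ->
  spanning_connected (Y :\ e).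
Proof.
move=> /spanning_connectedP h he; apply/spanning_connectedP=> u v.
apply: connect_sub (h u v) => x y /adjP[[f b] [/= fY <- <-]].
have [->|nfe] := eqVneq f e.
  by case: b => //=; rewrite connect_adj_sym.
by apply/connect1/adjP; exists (f, b); rewrite !inE nfe.
Qed.

Definition supported z Y := forall e, e \notin Y -> z (enum_rank e) 0 = 0.

(** The equations of [bd1 G *m z = 0] at the vertices of [S] add up to this: no net flow crosses a
    cut. *)
Lemma cycle_space_cut z (S : {set vert G}) : bd1 G *m z = 0 ->
  \sum_e ((etgt e \in S)%:R - (esrc e \in S)%:R) * z (enum_rank e) 0 = 0.
Proof.
move=> z0; have mem_sum v : (v \in S)%:R = \sum_(u in S) (v == u)%:R :> int.
  have [vS|vS] := boolP (v \in S).
    rewrite (bigD1 v) //= eqxx big1 ?addr0 // => u /andP[_].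
    by rewrite eq_sym => /negPf ->.
  by rewrite big1 // => u uS; case: eqP vS => // ->; rewrite uS.
under eq_bigr do rewrite !mem_sum -sumrB big_distrl /=.
by rewrite exchange_big big1 //= => v _; rewrite -bd1E z0 mxE.
Qed.

(* Otherwise [e] is the only edge of [Y] leaving the component of its source in
   [Y :\ e], and the flow [z] through this cut is not balanced. *)
Lemma connect_support z Y e :
  bd1 G *m z = 0 -> supported z Y -> z (enum_rank e) 0 != 0 ->
  connect (adj (Y :\ e)) (esrc e) (etgt e).
Proof.
move=> z0 zY; apply: contraR => nc.
set S := [set v | connect (adj (Y :\ e)) (esrc e) v].
have := cycle_space_cut S z0.
rewrite (bigD1 e) //= big1 ?addr0 => [|f nfe].
  rewrite !inE connect0 (negPf nc) sub0r mulN1r.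
  by move=> /eqP; rewrite oppr_eq0.
have [fY|/zY ->] := boolP (f \in Y); last by rewrite mulr0.
have fYe : f \in Y :\ e by rewrite !inE nfe.
rewrite !inE.
rewrite (same_connect_r (@connect_adj_sym _) (connect1 (adj_edge fYe))).
by rewrite subrr mul0r.
Qed.

Lemma path_dtgtE d s :
  path (fun d d' : edge G * bool => dtgt d == dsrc d') d s
  = (map (@dtgt G) (belast d s) == map (@dsrc G) s).
Proof. by elim: s d => //= d' s IHs d; rewrite IHs eqseq_cons. Qed.

Lemma cycle_dtgtE s :
  cycle (fun d d' : edge G * bool => dtgt d == dsrc d') s
  = (map (@dtgt G) s == rot 1 (map (@dsrc G) s)).
Proof.
case: s => //= d s.
by rewrite path_dtgtE belast_rcons map_rcons /rot /= drop0 take0 cats1.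
Qed.

Lemma bd1_delta (d : edge G * bool) (v : vert G) :
  (bd1 G *m ((-1) ^+ d.2 *: delta_mx (enum_rank d.1) 0 : 'cV_#|edge G|))
    (enum_rank v) 0
  = (dtgt d == v)%:R - (dsrc d == v)%:R.
Proof.
rewrite -scalemxAr -colE !mxE !enum_rankK.
by case: d => e [] /=; rewrite ?mul1r // mulN1r opprB.
Qed.

(** The targets of a closed walk are a rotation of its sources, so the two sums of vertex indicators
    cancel. *)
Lemma bd1_ocycle s : ocycle s -> bd1 G *m ocycle_vec s = 0.
Proof.
case/and4P=> _ _ _; rewrite cycle_dtgtE => /eqP tgtE.
apply/colP=> i; rewrite -(enum_valK i) mulmx_sumr summxE mxE.
under eq_bigr do rewrite bd1_delta.
pose F (u : vert G) : int := (u == enum_val i)%:R.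
rewrite sumrB -(big_map (@dtgt G) xpredT F) -(big_map (@dsrc G) xpredT F) tgtE.
by rewrite (perm_big (map (@dsrc G) s)) ?subrr //= perm_rot.
Qed.

Lemma ocycle_vecE s e :
  ocycle_vec s (enum_rank e) 0 = \sum_(d <- s | d.1 == e) (-1) ^+ d.2.
Proof.
rewrite summxE [RHS]big_mkcond; apply: eq_bigr => d _.
by rewrite !mxE eqxx andbT (inj_eq enum_rank_inj) eq_sym; case: eqP;
  rewrite ?mulr1 ?mulr0.
Qed.

Lemma ocycle_vec_notin s e :
  e \notin map fst s -> ocycle_vec s (enum_rank e) 0 = 0.
Proof.
move=> es; rewrite ocycle_vecE big_seq_cond big1 // => d /andP[ds /eqP de].
by rewrite -de map_f in es.
Qed.

Lemma ocycle_vec_in s e : uniq (map fst s) -> e \in map fst s ->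
  ocycle_vec s (enum_rank e) 0 ^+ 2 = 1.
Proof.
elim: s => //= d s IHs /andP[ds us].
rewrite ocycle_vecE big_cons inE eq_sym -ocycle_vecE.
by case: eqP => [<- _|_ /(IHs us)//];
  rewrite ocycle_vec_notin ?addr0 ?sqrr_sign.
Qed.

Lemma ocycle_vec_eq0 s e : ocycle s ->
  (ocycle_vec s (enum_rank e) 0 == 0) = (e \notin map fst s).
Proof.
case/and4P=> _ us _ _; have [es|/ocycle_vec_notin ->] := boolP (e \in _).
  by rewrite -sqrf_eq0 ocycle_vec_in.
by rewrite eqxx.
Qed.

Lemma ocycle_ex s : ocycle s -> exists e, e \in map fst s.
Proof. by case: s => // d s _; exists d.1; rewrite inE eqxx. Qed.

(** Edges are distinct because a later step along the edge of the first one, in either direction,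
    would revisit [u]. *)
Lemma simple_walk T u p : path (adj T) u p -> uniq (u :: p) ->
  exists s, [/\ map (@dsrc G) s = belast u p, map (@dtgt G) s = p,
                {subset map fst s <= T} & uniq (map fst s)].
Proof.
elim: p u => [|v p IHp] u /=; first by exists [::].
case/andP=> /adjP[d [dT du dv]] /IHp{}IHp /andP[uvp /IHp[s [ss st sT us]]].
exists (d :: s); rewrite /= ss st du dv us andbT; split=> //.
  by move=> e; rewrite inE => /predU1P[->|/sT].
apply: contra uvp => /mapP[d' d's d'd].
have src_in : dsrc d' \in v :: p by apply/mem_belast; rewrite -ss map_f.
have tgt_in : dtgt d' \in v :: p by rewrite inE -st map_f ?orbT.
move: du d'd src_in tgt_in; case: d d' {d's dv dT} => e b [e' b'] /= <- <-.
by case: b b' => [] [].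
Qed.

(** The cycle is [e] followed by a simple walk in [T] back to its source; for a loop this walk is
    empty. *)
Lemma close_cycle T e : e \notin T -> connect (adj T) (etgt e) (esrc e) ->
  exists s, [/\ ocycle s, e \in map fst s & {subset map fst s <= e |: T}].
Proof.
move=> eT /connectP[p0 p0P]; case/shortenP: p0P => p pP up _ plast.
have [s [ss st sT us]] := simple_walk pP up.
exists ((e, false) :: s); split; rewrite /= ?inE ?eqxx //; last first.
  move=> f; rewrite !inE => /predU1P[->|/sT ->]; first by rewrite eqxx.
  by rewrite orbT.
rewrite /ocycle cycle_dtgtE /= us ss st (contra (@sT e)) //=.
rewrite /rot /= drop0 take0 cats1.
have -> : dsrc (e, false) = last (etgt e) p by [].
rewrite -lastI eqxx andbT -(rcons_uniq (belast _ _) (last _ _)) -lastI.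
exact: up.
Qed.

Lemma is_cycleP (C : {set edge G}) :
  reflect (exists2 s, ocycle s & [set e in map fst s] = C) (is_cycle C).
Proof.
apply: (iffP existsP) => [[s /andP[sc /eqP]]|[s sc <-]]; first by exists s.
have sz : size s = #|[set e in map fst s]|.
  by rewrite cardsE (card_uniqP _) ?size_map //; case/and4P: sc.
by exists (Tuple (introT eqP sz)); rewrite /= sc eqxx.
Qed.

End Cycles.

(** * Spanning trees, cycletrees and the projection formula *)

Section Trees.
Variable G : mgraph.
Implicit Types (T Y : {set edge G}) (s : seq (edge G * bool)).
Implicit Types (z : 'cV[int]_#|edge G|) (e : edge G).

(** With trees as minimal connected sets, existence is immediate, and acyclicity takes the form of
    [spanning_tree_support]. *)
Definition spanning_tree T :=
  spanning_connected T && [forall e in T, ~~ spanning_connected (T :\ e)].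

Lemma spanning_tree_ex : spanning_connected [set: edge G] ->
  exists T, spanning_tree T.
Proof.
move=> cG; have [T /minsetP[cT minT] _] := minset_exists cG.
exists T; rewrite /spanning_tree cT; apply/forall_inP=> e eT.
apply: contraTN eT => /minT/(_ (subD1set _ _)) <-.
by rewrite !inE eqxx.
Qed.

(** By [connect_support], an edge where [z] is nonzero could be removed without disconnecting [T],
    against minimality. *)
Lemma spanning_tree_support T z : spanning_tree T ->
  bd1 G *m z = 0 -> supported z T -> z = 0.
Proof.
case/andP=> cT /forall_inP minT z0 zT; apply/colP=> i; rewrite mxE.
rewrite -(enum_valK i); set e := enum_val i.
have [eT|/zT//] := boolP (e \in T); apply/eqP.
apply: contraR (minT e eT) => /(connect_support z0 zT).
exact: spanning_connectedD1.
Qed.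

Lemma ocycle_supported s Y :
  {subset map fst s <= Y} -> supported (ocycle_vec s) Y.
Proof. by move=> sY e eY; rewrite ocycle_vec_notin // (contra (@sY e)). Qed.

Lemma cycletree_unique Y s s' : Y \in cycletrees G ->
  ocycle s -> {subset map fst s <= Y} ->
  ocycle s' -> {subset map fst s' <= Y} -> map fst s =i map fst s'.
Proof.
rewrite inE => /andP[_ /cards1P[C CY]].
have memC t : ocycle t -> {subset map fst t <= Y} -> [set e in map fst t] = C.
  move=> tc tY; apply/set1P; rewrite -CY inE; apply/andP; split.
    by apply/is_cycleP; exists t.
  by apply/subsetP=> e; rewrite inE => /tY.
move=> sc sY s'c s'Y e; have := memC _ sc sY.
by rewrite -(memC _ s'c s'Y) => /setP/(_ e); rewrite !inE.
Qed.

(** [Y :\ e] stays connected because [e] lies on a cycle; it is minimal because [Y] has no second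
    cycle. *)
Lemma cycletreeD1 Y s e : Y \in cycletrees G ->
  ocycle s -> {subset map fst s <= Y} -> e \in map fst s ->
  spanning_tree (Y :\ e).
Proof.
move=> YU sc sY es; have cY : spanning_connected Y by case/setIdP: YU.
have cYe : spanning_connected (Y :\ e).
  apply: spanning_connectedD1 cY _.
  apply: connect_support (bd1_ocycle sc) (ocycle_supported sY) _.
  by rewrite ocycle_vec_eq0 ?es.
rewrite /spanning_tree cYe; apply/forall_inP=> f fYe.
apply/negP=> /spanning_connectedP cYef.
(* If [f] could be removed too, closing it up would give a cycle of [Y] that avoids [e]. *)
have [|s' [s'c fs' s'Yef]] := close_cycle _ (cYef (etgt f) (esrc f)).
  by rewrite !inE eqxx.
have s'Y : {subset map fst s' <= Y :\ e}.
  by move=> g /s'Yef; rewrite setD1K.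
have /s'Y : e \in map fst s'.
  by rewrite -(cycletree_unique YU sc sY s'c) // => g /s'Y /setD1P[].
by rewrite !inE eqxx.
Qed.

Lemma spanning_treeU1 T e : spanning_tree T -> e \notin T ->
  e |: T \in cycletrees G.
Proof.
move=> tT eT; have [cT _] := andP tT.
have [s [sc es sT]] :=
  close_cycle eT (spanning_connectedP _ cT (etgt e) (esrc e)).
rewrite inE (spanning_connectedS _ cT) ?subsetUr //=.
apply/cards1P; exists [set f in map fst s]; apply/setP=> C.
rewrite !inE; apply/andP/eqP=> [[/is_cycleP[s' s'c <-] /subsetP s'T]|->];
  last first.
  split; first by apply/is_cycleP; exists s.
  by apply/subsetP=> f; rewrite inE => /sT.
(* The combination of the two cycle vectors that vanishes at [e] is supported
   in the tree, so it is zero. *)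
set a := ocycle_vec s (enum_rank e) 0.
set a' := ocycle_vec s' (enum_rank e) 0.
have s'T' : {subset map fst s' <= e |: T}.
  by move=> f fs'; apply: s'T; rewrite inE.
have dep : a *: ocycle_vec s' - a' *: ocycle_vec s = 0.
  apply: (spanning_tree_support tT).
    by rewrite mulmxBr -!scalemxAr !bd1_ocycle // !scaler0 subrr.
  move=> f fT; rewrite !mxE.
  have [->|nfe] := eqVneq f e; first by rewrite mulrC subrr.
  have fTe : f \notin e |: T by rewrite !inE negb_or nfe.
  by rewrite !(ocycle_supported _ fTe) // !mulr0 subrr.
have a0 : a != 0 by rewrite ocycle_vec_eq0 ?es.
have a'0 : a' != 0.
  apply/eqP=> a'0; move/eqP: dep.
  rewrite a'0 scale0r subr0 scalemx_eq0 (negPf a0) => /eqP /= z0.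
  have [f] := ocycle_ex s'c; apply/negP.
  by rewrite -ocycle_vec_eq0 // z0 mxE.
(* Since [a] and [a'] are nonzero, the two proportional vectors have the same support, and the
   supports are the edge sets of the cycles. *)
apply/setP=> f; rewrite !inE; apply: negb_inj; rewrite -!ocycle_vec_eq0 //.
move/colP/(_ (enum_rank f)): dep; rewrite !mxE => /eqP.
rewrite subr_eq0 => /eqP fE.
apply/eqP/eqP=> z0; move/eqP: fE; rewrite z0 mulr0.
  by rewrite eq_sym mulf_eq0 (negPf a'0) => /eqP.
by rewrite mulf_eq0 (negPf a0) => /eqP.
Qed.

Variable zc : {set edge G} -> 'cV[int]_#|edge G|.
Hypothesis hzc : forall Y, Y \in cycletrees G -> cycle_vec_of Y (zc Y).

Lemma bd1_zc Y : Y \in cycletrees G -> bd1 G *m zc Y = 0.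
Proof. by move=> /hzc[s [sc _ ->]]; exact: bd1_ocycle. Qed.

Lemma zc_supported Y : Y \in cycletrees G -> supported (zc Y) Y.
Proof. by move=> /hzc[s [_ sY ->]]; exact: ocycle_supported. Qed.

Lemma zc_sqr Y e : Y \in cycletrees G -> zc Y (enum_rank e) 0 != 0 ->
  zc Y (enum_rank e) 0 ^+ 2 = 1.
Proof.
move=> /hzc[s [sc _ ->]]; rewrite ocycle_vec_eq0 // negbK.
by apply: ocycle_vec_in; case/and4P: sc.
Qed.

(** This turns pairs of a cycletree and an edge of its cycle into pairs of a tree and an edge
    outside it. *)
Lemma cycletree_treeE Y e :
  (Y \in cycletrees G) && (zc Y (enum_rank e) 0 != 0)
  = (e \in Y) && spanning_tree (Y :\ e).
Proof.
apply/andP/andP=> [[YU]|[eY tY]].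
  have [s [sc sY ->]] := hzc YU; rewrite ocycle_vec_eq0 // negbK => es.
  by rewrite sY // (cycletreeD1 YU sc).
have YU : Y \in cycletrees G.
  by rewrite -(setD1K eY) spanning_treeU1 // !inE eqxx.
(* Otherwise [zc Y] is supported in the tree [Y :\ e], so it vanishes, which no cycle vector
   does. *)
split=> //; apply/eqP=> ze0.
have z0 : zc Y = 0.
  apply: spanning_tree_support tY (bd1_zc YU) _ => f.
  rewrite !inE negb_and negbK => /predU1P[->//|]; exact: zc_supported.
have [s [sc sY zs]] := hzc YU; have [f] := ocycle_ex sc; apply/negP.
by rewrite -ocycle_vec_eq0 // -zs z0 mxE.
Qed.

(** The difference of the two sides is a cycle supported in [T]: at [f] outside [T] only the term of
    [f] contributes. The factor [zc (e |: T) (enum_rank e) 0] is a sign that undoes the choice of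
    orientation. *)
Lemma spanning_tree_decomposition T z : spanning_tree T -> bd1 G *m z = 0 ->
  z = \sum_(e | e \notin T)
        (zc (e |: T) (enum_rank e) 0 * z (enum_rank e) 0) *: zc (e |: T).
Proof.
move=> tT z0; apply/eqP; rewrite -subr_eq0; apply/eqP.
apply: (spanning_tree_support tT).
  rewrite mulmxBr z0 mulmx_sumr big1 ?subrr // => e eT.
  by rewrite -scalemxAr bd1_zc ?scaler0 ?spanning_treeU1.
move=> f fT; rewrite mxE [X in _ + X]mxE summxE (bigD1 f) //=.
rewrite big1 => [|e /andP[eT nef]]; last first.
  have /zc_supported/(_ f) zf := spanning_treeU1 tT eT.
  rewrite mxE zf ?mulr0 //.
  by rewrite !inE eq_sym negb_or nef.
have /andP[fU fnz] : (f |: T \in cycletrees G) &&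
    (zc (f |: T) (enum_rank f) 0 != 0).
  by rewrite cycletree_treeE setU1K // !inE eqxx.
by rewrite addr0 mxE mulrAC -expr2 zc_sqr // mul1r subrr.
Qed.

(* Sum the fundamental cycle decomposition over all trees [T], and exchange the
   pairs [(T, e)], [e \notin T], for the pairs [(Y, e)], [e] on the cycle of
   [Y], by [Y = e |: T]. *)
Lemma cycletree_projection z : bd1 G *m z = 0 ->
  (\sum_(Y in cycletrees G) zc Y *m (zc Y)^T) *m z
  = #|[set T | spanning_tree T]|%:R *: z.
Proof.
move=> z0; rewrite mulmx_suml.
pose F Y e := (zc Y (enum_rank e) 0 * z (enum_rank e) 0) *: zc Y.
transitivity (\sum_(Y in cycletrees G) \sum_e F Y e).
  apply: eq_bigr => Y _; rewrite -mulmxA [_^T *m _]mx11_scalar mul_mx_scalar.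
  by rewrite mxE sum_edge scaler_suml; apply: eq_bigr => e _; rewrite mxE.
transitivity (\sum_(T | spanning_tree T) z); last first.
  by rewrite sumr_const scaler_nat cardsE.
transitivity (\sum_(T | spanning_tree T) \sum_(e | e \notin T) F (e |: T) e);
  last by apply: eq_bigr => T tT; rewrite -spanning_tree_decomposition.
rewrite exchange_big [RHS](exchange_big_dep xpredT) //=; apply: eq_bigr => e _.
(* Cycletrees whose cycle avoids [e] contribute nothing; the others are reindexed by
   [T = Y :\ e]. *)
rewrite (bigID (fun Y => zc Y (enum_rank e) 0 != 0)) /= [X in _ + X]big1 ?addr0.
  rewrite (eq_bigl _ _ (fun Y => cycletree_treeE Y e)).
  rewrite (reindex_onto (fun T => e |: T) (fun Y => Y :\ e)) /=.
    apply: eq_bigl => T; rewrite !inE eqxx /=.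
    apply/andP/andP=> [[tT /eqP eT]|[tT eT]]; last by rewrite setU1K.
    by rewrite -eT !inE eqxx.
  by move=> Y /andP[eY _]; rewrite setD1K.
by move=> Y /andP[_ /negPn/eqP z0e]; rewrite /F z0e mul0r scale0r.
Qed.

End Trees.

(** * Kernels of matrices over integral domains *)

Section LinearAlgebra.

(** Zero rows pad [A] to a singular square matrix; [det0P] finds the vector over [D] itself. *)
Lemma wide_mx_ker (D : idomainType) p q (A : 'M[D]_(p, q)) : (p < q)%N ->
  exists2 v : 'cV[D]_q, v != 0 & A *m v = 0.
Proof.
move=> ltpq.
pose A' := \matrix_(i < q, j < q)
  (if insub (i : nat) is Some i' then A i' j else 0).
have : \det A'^T == 0.
  rewrite det_tr (expand_det_row _ (Ordinal ltpq)) big1 // => j _.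
  by rewrite mxE insubF ?mul0r //= ltnn.
case/det0P=> v v0 vA; exists v^T; first by rewrite trmx_eq0.
apply/colP=> i; rewrite [RHS]mxE.
move/rowP/(_ (widen_ord (ltnW ltpq) i)): vA; rewrite !mxE => vA.
rewrite -[RHS]vA; apply: eq_bigr => j _; rewrite !mxE mulrC.
by rewrite insubT //= => lti; congr (_ * A _ _); apply: val_inj.
Qed.

Lemma trmx_mul_self_eq0 (D : realDomainType) p (u : 'cV[D]_p) :
  (u^T *m u) 0 0 = 0 -> u = 0.
Proof.
rewrite mxE; under eq_bigr do rewrite mxE -expr2.
move/eqP; rewrite psumr_eq0 => [/allP u0|i _]; last exact: sqr_ge0.
apply/colP=> i; rewrite mxE; apply/eqP; rewrite -sqrf_eq0.
by apply: u0; rewrite mem_index_enum.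
Qed.

(** Pairing the left equation with [x] gives two squared norms that add up to zero. *)
Lemma gram_add_ker (D : realDomainType) p q r
    (A : 'M[D]_(p, q)) (B : 'M[D]_(q, r)) (x : 'cV[D]_q) :
  (A^T *m A + B *m B^T) *m x = 0 <-> A *m x = 0 /\ B^T *m x = 0.
Proof.
split=> [Lx|[Ax Bx]]; last by rewrite mulmxDl -!mulmxA Ax Bx !mulmx0 addr0.
have : ((A *m x)^T *m (A *m x)) 0 0 + ((B^T *m x)^T *m (B^T *m x)) 0 0 = 0.
  have := congr1 (fun M => (x^T *m M) 0 0) Lx.
  by rewrite mulmx0 mulmxDl mulmxDr !trmx_mul trmxK !mulmxA !mxE.
have sq_ge0 k (u : 'cV[D]_k) : 0 <= (u^T *m u) 0 0.
  by rewrite mxE sumr_ge0 // => i _; rewrite mxE -expr2 sqr_ge0.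
by move/eqP; rewrite paddr_eq0 // => /andP[/eqP /trmx_mul_self_eq0 -> /eqP
  /trmx_mul_self_eq0 ->].
Qed.

End LinearAlgebra.

(** * Coordinates of a unicyclizer and the winding number *)

Section Winding.
Variables (G : mgraph) (n m : nat).
Variables (bd2 : 'M[int]_(#|edge G|, n)) (beta : 'M[int]_(#|edge G|, m)).
Hypothesis hbeta : Z1_basis beta.

Lemma coord_vecK (c : 'cV[int]_m) : coord_vec beta (beta *m c) = c.
Proof.
have [_ inj _] := hbeta; rewrite /coord_vec.
case: xgetP => [d _ /= bd|/(_ c)//].
by apply/eqP; rewrite -subr_eq0; apply/eqP/inj; rewrite mulmxBr bd subrr.
Qed.

Lemma coord_vecE (z : 'cV[int]_#|edge G|) :
  bd1 G *m z = 0 -> beta *m coord_vec beta z = z.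
Proof. by case: hbeta => _ _ /(_ z) h /h[c <-]; rewrite coord_vecK. Qed.

Hypothesis hbd2 : unicyclizer bd2.

Let B := coord_mx beta bd2.

Lemma coord_mxE : beta *m coord_mx beta bd2 = bd2.
Proof.
have [_ bd12 _] := hbd2; apply/matrixP => i j.
have colj : bd1 G *m col j bd2 = 0 by rewrite colE mulmxA bd12 mul0mx.
have /colP/(_ i) := coord_vecE colj; rewrite [in RHS]mxE => <-.
by rewrite !mxE; apply: eq_bigr => k _; rewrite mxE.
Qed.

(** [c0] holds the coordinates of a cycle of infinite order modulo the image of [bd2], supplied by
    the existence half of the rank condition. *)
Lemma unicyclizer_complement : exists c0 : 'cV[int]_m,
  forall (a : int) (x : 'cV[int]_n), a *: c0 = B *m x -> a = 0 /\ x = 0.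
Proof.
have [inj _ [[Z [Z0 indZ]] _]] := hbd2; exists (coord_vec beta Z) => a x ax.
have a0 : a%:M = 0 :> 'M_1.
  apply: indZ; exists x; rewrite mul_mx_scalar -{1}(coord_vecE Z0) scalemxAr ax.
  by rewrite mulmxA coord_mxE.
have {}a0 : a = 0.
  by have := congr1 (fun M : 'M[int]_1 => M 0 0) a0; rewrite !mxE eqxx.
split=> //; apply: inj; rewrite -coord_mxE -mulmxA -/B -ax a0 scale0r.
exact: mulmx0.
Qed.

(* With [n + 2 <= m], some vector is orthogonal to [c0] and to the columns of
   [B], so that its class and that of [c0] contradict the rank being [1]. *)
Lemma unicyclizer_rank : m = n.+1.
Proof.
have [c0 indc0] := unicyclizer_complement.
have [_ _ [_ maxr]] := hbd2; have [bdb injb _] := hbeta.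
apply/eqP; rewrite eqn_leq; apply/andP; split; rewrite leqNgt;
  apply/negP => ltm.
  have [v v0 vA] := wide_mx_ker (col_mx c0^T B^T) ltm.
  move: vA; rewrite mul_col_mx => /eqP; rewrite col_mx_eq0.
  case/andP=> /eqP c0v /eqP Bv.
  have v0' : (v^T *m v) 0 0 != 0.
    by apply: contra v0 => /eqP /trmx_mul_self_eq0 ->.
  have /negP[] : ~~ (1 + 1 <= 1)%N by [].
  apply: (maxr _ (beta *m row_mx c0 v)); first by rewrite mulmxA bdb mul0mx.
  move=> c [x cx]; rewrite -[c]vsubmxK in cx *.
  set a := usubmx c in cx *; set b := dsubmx c in cx *.
  have {}cx : c0 *m a + v *m b = B *m x.
    apply/eqP; rewrite -subr_eq0; apply/eqP/injb.
    rewrite mulmxBr -mul_row_col !mulmxA cx coord_mxE; exact: subrr.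
  have vc0 : v^T *m c0 = 0 by apply: trmx_inj; rewrite trmx_mul trmxK c0v trmx0.
  have vB : v^T *m B = 0 by apply: trmx_inj; rewrite trmx_mul trmxK Bv trmx0.
  (* Multiplying [cx] by [v^T] leaves only [v^T *m v *m b = 0], and [v^T *m v] is nonzero. *)
  have b0 : b = 0.
    have := congr1 (fun M => (v^T *m M) 0 0) cx.
    rewrite mulmxDr !mulmxA vc0 vB !mul0mx add0r [b]mx11_scalar mul_mx_scalar.
    rewrite !mxE => /eqP; rewrite mulf_eq0 => /orP[/eqP ->|].
      by rewrite raddf0.
    by move: v0'; rewrite mxE => /negPf ->.
  move: cx; rewrite b0 mulmx0 addr0 [a]mx11_scalar mul_mx_scalar.
  by case/indc0=> -> _; rewrite raddf0 col_mx0.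
(* With [m <= n], the columns of [row_mx c0 B] would be dependent. *)
have [v v0 vA] := wide_mx_ker (row_mx c0 B) ltm.
move: vA v0; rewrite -[v]vsubmxK mul_row_col [usubmx v]mx11_scalar mul_mx_scalar.
move/eqP; rewrite addr_eq0 -mulmxN => /eqP /indc0[-> /eqP].
by rewrite oppr_eq0 => /eqP ->; rewrite raddf0 col_mx0 eqxx.
Qed.

End Winding.

(* Expansion along the first column; the other columns of the matrix of [winding]
   do not depend on its argument. *)
Lemma winding_linear (G : mgraph) (n m : nat)
    (bd2 : 'M[int]_(#|edge G|, n)) (beta : 'M[int]_(#|edge G|, m)) :
  Z1_basis beta -> unicyclizer bd2 ->
  exists phi : 'rV[int]_m,
    [/\ phi != 0, phi *m coord_mx beta bd2 = 0
      & forall c, winding beta bd2 (beta *m c) = (phi *m c) 0 0].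
Proof.
move=> hbeta hbd2; have mE := unicyclizer_rank hbeta hbd2; subst m.
have [c0 indc0] := unicyclizer_complement hbeta hbd2.
set B := coord_mx beta bd2 in indc0 *.
pose A c : 'M[int]_(1 + n) := row_mx c B.
pose phi : 'rV[int]_(1 + n) := \row_i cofactor (A 0) i 0.
have detA c : \det (A c) = (phi *m c) 0 0.
  rewrite (expand_det_col _ 0) mxE; apply: eq_bigr => i _.
  rewrite mxE mulrC; congr (_ * _); last first.
    by case: split_ordP => // k _; rewrite [k]ord1.
  rewrite mxE /cofactor /A; congr (_ * \det _); apply/matrixP=> a b.
  rewrite !mxE.
  by case: split_ordP => // k /(congr1 val) /=; rewrite [k]ord1.
exists phi; split.
(* If [phi] were zero, [A c0] would be singular, and a kernel vector would contradict the choice of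
   [c0]. *)
- apply/eqP=> phi0.
  have : \det (A c0)^T == 0 by rewrite det_tr detA phi0 mul0mx mxE.
  case/det0P=> v v0 /(congr1 trmx); rewrite trmx_mul trmxK trmx0.
  rewrite -[X in A c0 *m X](vsubmxK (m1 := 1)) mul_row_col [usubmx _]mx11_scalar mul_mx_scalar.
  move/eqP; rewrite addr_eq0 -mulmxN => /eqP /indc0[u0 /eqP].
  rewrite oppr_eq0 => /eqP d0; case/negP: v0; rewrite -trmx_eq0.
  rewrite -[v^T](vsubmxK (m1 := 1)) d0 [usubmx _]mx11_scalar u0.
  by rewrite raddf0 col_mx0.
(* The value of [phi] at a column of [B] is the determinant of a matrix in which that column occurs
   twice. *)
- apply/rowP=> j; rewrite [RHS]mxE.
  transitivity ((phi *m col j B) 0 0).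
    by rewrite colE mulmxA -colE [RHS]mxE.
  rewrite -detA -det_tr.
  apply: (@determinant_alternate _ _ _ (lshift n 0) (rshift 1 j)).
    by rewrite eq_lrshift.
  by move=> i; rewrite [LHS]mxE [RHS]mxE /A row_mxEl row_mxEr mxE.
- by move=> c; rewrite /winding conform_mx_id coord_vecK // -detA.
Qed.

Theorem theorem5p2p1 (R : realType) (G : mgraph) (n m : nat)
    (bd2 : 'M[int]_(#|edge G|, n)) (beta : 'M[int]_(#|edge G|, m))
    (zc : {set edge G} -> 'cV[int]_#|edge G|)
    (hG : connected_graph G)
    (hbd2 : unicyclizer bd2)
    (hbeta : Z1_basis beta)
    (hzc : forall Y, Y \in cycletrees G -> cycle_vec_of Y (zc Y)) :
  let lambda := std_harmonic_cycle beta bd2 zc in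
  [/\ lambda <> 0,
      harmonic bd2 (map_mx intr lambda : 'cV[R]_#|edge G|)
    & forall x : 'cV[R]_#|edge G|,
        harmonic bd2 x <->
        map_mx intr (bd1 G) *m x = 0 /\ map_mx intr bd2^T *m x = 0].
Proof.
have [phi [phi0 phiB windE]] := winding_linear hbeta hbd2.
have [bdb injb _] := hbeta.
move=> lambda; set k : int := #|[set T : {set edge G} | spanning_tree T]|%:R.
have k0 : k != 0.
  have /andP[_ /spanning_tree_ex[T tT]] := hG.
  by rewrite pnatr_eq0 -lt0n; apply/card_gt0P; exists T; rewrite inE.
pose coord Y := coord_vec beta (zc Y).
have coordE Y : Y \in cycletrees G -> beta *m coord Y = zc Y.
  by move=> YU; rewrite coord_vecE // bd1_zc.
(* [beta *m Q] is the matrix of the projection formula; [Q] gives its values in coordinates. *)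
pose Q := \sum_(Y in cycletrees G) coord Y *m (zc Y)^T.
have lambdaT : lambda^T = phi *m Q.
  rewrite mulmx_sumr raddf_sum; apply: eq_bigr => Y YU /=.
  rewrite -{1}(coordE Y YU) windE linearZ mulmxA /=.
  by rewrite [phi *m _ in RHS]mx11_scalar mul_scalar_mx.
(* As [beta] is injective, this is the projection formula on the columns of [beta]. *)
have Qbeta : Q *m beta = k%:M.
  apply/eqP; rewrite -subr_eq0; apply/eqP/matrixP=> i j.
  have bj : bd1 G *m (beta *m delta_mx j 0 : 'cV_#|edge G|) = 0.
    by rewrite mulmxA bdb mul0mx.
  have /colP/(_ i) : (Q *m beta - k%:M) *m delta_mx j 0 = 0 :> 'cV_m.
    apply: injb; rewrite mulmxBl mulmxBr mul_scalar_mx -scalemxAr.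
    rewrite -(cycletree_projection hzc bj) !mulmxA mulmx_sumr.
    under eq_bigr => Y YU do rewrite mulmxA coordE //.
    exact: subrr.
  by rewrite -colE mxE => ->; rewrite !mxE.
(* On the basis [beta], pairing with [lambda] is [k] times the winding number. *)
have lambda_beta : lambda^T *m beta = k *: phi.
  by rewrite lambdaT -mulmxA Qbeta mul_mx_scalar.
have bd1_lambda : bd1 G *m lambda = 0.
  rewrite mulmx_sumr big1 // => Y YU.
  by rewrite -scalemxAr (bd1_zc hzc YU) scaler0.
(* [bd2] factors as [beta *m coord_mx beta bd2], and [phi] kills the second factor. *)
have bd2_lambda : bd2^T *m lambda = 0.
  apply: trmx_inj; rewrite trmx_mul trmxK trmx0 -(coord_mxE hbeta hbd2) mulmxA.
  by rewrite lambda_beta -scalemxAl phiB scaler0.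
have harmonicE (x : 'cV[R]_#|edge G|) : harmonic bd2 x <->
    map_mx intr (bd1 G) *m x = 0 /\ map_mx intr bd2^T *m x = 0.
  rewrite /harmonic /laplacian map_mxD !map_mxM -!map_trmx; exact: gram_add_ker.
split=> //.
- move=> lambda0; move/eqP: lambda_beta.
  by rewrite lambda0 trmx0 mul0mx eq_sym scalemx_eq0 (negPf k0) (negPf phi0).
- apply/harmonicE; rewrite -!map_mxM /=.
  by split; [rewrite bd1_lambda|rewrite bd2_lambda]; rewrite map_mx0.
Qed.
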